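(* Let $r_0$ be the unique number such that $1/2<r_0<1$ and $$(3r_0+1)3^{1/r_0}=\frac{63}{4}.$$ Let $n\ge 2$, let $0<x_1\le x_2\le\cdots\le x_n$, let $q_1,\dots,q_n>0$ with $\sum_{i=1}^n q_i=1$, and let $q=\min_i q_i$. (i) For $r_0\le r\le 1$, $$M_{n,\frac12}-q^{2-1/r}M_{n,r}-(1-q^{2-1/r})G_n\ \le\ \frac{1/2-rq^{2-1/r}}{2x_1}\,\sigma_n,$$ with equality holding if and only if $x_1=x_2=\cdots=x_n$ or $r=1$, $n=2$, $q=1/2$. (ii) For $1\le r\le 2$, $$M_{n,\frac12}-(1-q)^{2-1/r}M_{n,r}-(1-(1-q)^{2-1/r})G_n\ \ge\ \frac{1/2-r(1-q)^{2-1/r}}{2x_1}\,\sigma_n,$$ with equality holding if and only if $x_1=x_2=\cdots=x_n$.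
   Context: For ${\bf x}=(x_1,\dots,x_n)$ and weights ${\bf q}=(q_1,\dots,q_n)$ as in the claim, the weighted power means are $M_{n,p}=\left(\sum_{i=1}^n q_ix_i^p\right)^{1/p}$ for real $p\ne 0$, and $M_{n,0}=\lim_{p\to0}M_{n,p}=\prod_{i=1}^n x_i^{q_i}$. We write $A_n=M_{n,1}$, $G_n=M_{n,0}$, and $\sigma_n=\sum_{i=1}^n q_i(x_i-A_n)^2$.
   Formalization: In (ii) the equality condition also includes the case r=1, n=2, q=1/2, as in (i): there both sides vanish for all x_1≤x_2, so the printed condition (only x_1=...=x_n) fails. *)

(* Defs.v *)
From mathcomp Require Import all_boot all_order all_algebra.
From mathcomp Require Import all_classical all_reals all_analysis.

Set Implicit Arguments.
Unset Strict Implicit.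
Unset Printing Implicit Defensive.

Import Order.TTheory GRing.Theory Num.Theory.

Local Open Scope ring_scope.

Definition is_r0 (R : realType) (r0 : R) : Prop :=
  [/\ 1 / 2 < r0, r0 < 1 & (3 * r0 + 1) * 3 `^ (1 / r0) = 63 / 4].

(* Indices are 0-based: x_1, ..., x_n in the usual notation are the values of x
   at the elements of 'I_n, and x_1 is x (first_ord hn). *)
Definition first_ord (n : nat) (hn : (1 < n)%N) : 'I_n := Ordinal (ltnW hn).

(* The value at p = 0 is the limit of the other values as p tends to 0. *)
Definition power_mean (R : realType) (n : nat) (w x : 'I_n -> R) (p : R) : R :=
  if p == 0 then \prod_(i < n) x i `^ w i
  else (\sum_(i < n) w i * x i `^ p) `^ (1 / p).

Definition arith_mean (R : realType) (n : nat) (w x : 'I_n -> R) : R :=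
  power_mean w x 1.

Definition geom_mean (R : realType) (n : nat) (w x : 'I_n -> R) : R :=
  power_mean w x 0.

Definition weighted_variance (R : realType) (n : nat) (w x : 'I_n -> R) : R :=
  \sum_(i < n) w i * (x i - arith_mean w x) ^+ 2.

(* The default of the iterated minimum is itself one of the weights, so this is
   the minimum of the family w. *)
Definition min_weight (R : realType) (n : nat) (hn : (1 < n)%N)
    (w : 'I_n -> R) : R :=
  \big[Num.min/w (first_ord hn)]_(i < n) w i.

(* Main.v *)
Require Import Defs.
From mathcomp Require Import all_boot all_order all_algebra.
From mathcomp Require Import all_classical all_reals all_analysis.
From mathcomp Require Import ring lra.

(** Put gap = rhs - lhs, regarded as a function of x for a fixed factor
    c = q ^ (2 - 1/r) or c = (1 - q) ^ (2 - 1/r) and a fixed smallest value x_1.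
    It vanishes when all x_i are equal, so it is enough to know the sign of its
    derivative along a path from the constant family (x_1, ..., x_1) to x.  The
    path raises together all values of index greater than k, from x_k to
    x_(k+1), for k = 1, ..., n - 1 (gap_sign).  Divided by the weight of the
    moving values, whose common value is s, the derivative is
      (1/2 - rc) (s - A) / x_1 + c (M_r / s)^(1-r) + (1-c) G / s
        - (M_(1/2) / s)^(1/2).

    In the variables y_i = sqrt (x_i / s), which lie in ]0, 1], the last term is
    the mean m of the y_i.  Since M_r >= M_(1/2), the second term is at least
    (r <= 1) or at most (r >= 1) c m^(2-2r), and then only m, the variance term
    and the geometric mean remain.  Convexity reduces these to the case of two
    values without changing m: for r <= 1 every y_i is spread over the extreme
    values y_1 and 1 (slope_below), for r >= 1 all values but the largest one are
    merged (slope_above).  The mass S at the lower of the two values y then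
    satisfies q <= S <= 1 - q, because q is the smallest weight.

    For two values the claim concerns
      (1/2 - rc) S (1 - y^2) / y^2 + c m^(2-2r) + (1-c) y^(2S) - m
    with m = 1 - S (1 - y).  The terms of order at most 1 in 1 - y cancel.
    Bounding both powers to second order (powR_taylor_ge, powR_taylor_le) leaves
    conditions that no longer involve y and are affine in S
    (second_order_below, second_order_above).  Bounding c by its own
    second-order expansion turns them into the positivity of polynomials in
    e = 2 - 1/r and u = 1 - 2q, whose coefficients in the Bernstein basis are
    nonnegative.  All these inequalities are strict except when r = 1 and
    q = 1/2; the weights are then two halves and gap vanishes identically
    (gap_two_equal_weights).

    Existence of r_0 is the intermediate value theorem between 1/2 and 1, where
    (3r + 1) 3^(1/r) equals 45/2 and 12. *)

Set Implicit Arguments.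
Unset Strict Implicit.
Unset Printing Implicit Defensive.

Import Order.TTheory GRing.Theory Num.Theory.
Import numFieldNormedType.Exports.

Local Open Scope ring_scope.

(** * Derivatives and Bernoulli inequalities *)

Lemma is_derive_add (R : realType) (f g : R -> R) (x df dg : R) :
  is_derive x 1 f df -> is_derive x 1 g dg ->
  is_derive x 1 (fun t => f t + g t) (df + dg).
Proof. by move=> hf hg; exact: is_deriveD. Qed.

Lemma is_derive_sub (R : realType) (f g : R -> R) (x df dg : R) :
  is_derive x 1 f df -> is_derive x 1 g dg ->
  is_derive x 1 (fun t => f t - g t) (df - dg).
Proof. by move=> hf hg; exact: is_deriveB. Qed.

Lemma is_derive_const (R : realType) (k x : R) :
  is_derive x 1 (fun=> k) 0.
Proof. exact: is_derive_cst. Qed.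

Lemma is_derive_scale (R : realType) (k : R) (f : R -> R) (x df : R) :
  is_derive x 1 f df -> is_derive x 1 (fun t => k * f t) (k * df).
Proof. by move=> hf; exact: is_deriveZ. Qed.

Lemma is_derive_sqr (R : realType) (f : R -> R) (x df : R) :
  is_derive x 1 f df -> is_derive x 1 (fun t => f t ^+ 2) (2 * f x * df).
Proof.
move=> hf; have -> : 2 * f x * df = f x *: df + f x *: df.
  by rewrite -[_ *: _]/(_ * _); ring.
have -> : (fun t => f t ^+ 2) = f * f by apply/funext => t; rewrite expr2.
exact: is_deriveM.
Qed.

Lemma is_derive_comp (R : realType) (f g : R -> R) (x df dg : R) :
  is_derive (g x) 1 f df -> is_derive x 1 g dg ->
  is_derive x 1 (fun t => f (g t)) (df * dg).
Proof.
by move=> hf hg; exact: is_derive1_comp.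
Qed.

Lemma is_derive_powR (R : realType) (a : R) (f : R -> R) (x df : R) :
  0 < f x -> is_derive x 1 f df ->
  is_derive x 1 (fun t => f t `^ a) (a * f x `^ (a - 1) * df).
Proof.
move=> fx0 hf; apply: (@is_derive_comp _ (fun t => t `^ a) f) => //.
exact: is_derive1_powR.
Qed.

Lemma mean_value (R : realType) (f df : R -> R) (a b : R) :
  a < b -> (forall t : R, a <= t <= b -> is_derive t 1 f (df t)) ->
  exists2 t, a < t < b & f b - f a = df t * (b - a).
Proof.
move=> ab hf; have [||t] := @MVT R f df a b ab; last first.
- by rewrite in_itv /= => tab ->; exists t.
- apply: derivable_within_continuous => t; rewrite in_itv /= => tab.
  by have := hf t tab; case.
- by move=> t; rewrite in_itv /= => /andP[at_ tb]; apply: hf; rewrite !ltW.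
Qed.

(** Every bound on powers below is obtained by comparing a function that
    vanishes at 1 with its value there. *)
Lemma le_value_at_one (R : realType) (f df : R -> R) (z : R) :
  (forall t : R, 0 < t -> is_derive t 1 f (df t)) ->
  (forall t, 0 < t < 1 -> 0 <= df t) -> 0 < z <= 1 -> f z <= f 1.
Proof.
move=> hf df0 /andP[z0]; rewrite le_eqVlt => /orP[/eqP-> //|z1].
have [t /andP[zt _]|t /andP[zt t1] e] := @mean_value _ f df z 1 z1.
  by apply: hf; exact: lt_le_trans zt.
rewrite -subr_ge0 e mulr_ge0 ?subr_ge0 ?(ltW z1) // df0 // t1.
by rewrite (lt_trans z0).
Qed.

Lemma ln_le_sub1 (R : realType) (x : R) : 0 < x -> ln x <= x - 1.
Proof.
move=> x0; have := @le_ln1Dx R (x - 1).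
by rewrite (_ : 1 + (x - 1) = x); [apply; lra | ring].
Qed.

Lemma bernoulli_ge (R : realType) (b w : R) : 0 < w -> b <= 0 ->
  1 + b * (w - 1) <= w `^ b.
Proof.
move=> w0 b0; rewrite /powR gt_eqF //; apply: le_trans (expR_ge1Dx _).
by rewrite lerD2l ler_wnM2l // ln_le_sub1.
Qed.

(** Weighted arithmetic-geometric mean inequality for w and 1 with weights b and
    1 - b: with v = b * w + (1 - b), the tangent of ln at v bounds ln w and
    ln 1, and the two bounds average to 0. *)
Lemma bernoulli_le (R : realType) (b w : R) : 0 < w -> 0 <= b <= 1 ->
  w `^ b <= 1 + b * (w - 1).
Proof.
move=> w0 /andP[b0 b1].
have v0 : 0 < 1 + b * (w - 1) by have := mulr_ge0 b0 (ltW w0); nra.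
have /= h1 := ln_le_sub1 (divr_gt0 w0 v0).
have /= h2 := ln_le_sub1 (divr_gt0 ltr01 v0).
move: h1 h2; rewrite !ln_div ?posrE // ln1 => h1 h2.
rewrite /powR gt_eqF // -[leRHS]lnK ?posrE // ler_expR.
have e : b * (w / (1 + b * (w - 1)) - 1) + (1 - b) * (1 / (1 + b * (w - 1)) - 1) = 0.
  by field; rewrite gt_eqF.
have b1' : 0 <= 1 - b by lra.
have := ler_wpM2l b0 h1; have := ler_wpM2l b1' h2; lra.
Qed.

Lemma bernoulli_ge1 (R : realType) (a w : R) : 0 < w -> 1 <= a ->
  1 + a * (w - 1) <= w `^ a.
Proof.
move=> w0 a1; have a0 : 0 < a by lra.
have [v0|v0] := leP (1 + a * (w - 1)) 0; first exact: le_trans (powR_ge0 _ _).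
have ha : 0 <= a^-1 <= 1 by rewrite invr_ge0 ltW //= invf_le1.
have e : 1 + a^-1 * (1 + a * (w - 1) - 1) = w by field; rewrite gt_eqF.
have := bernoulli_le v0 ha; rewrite e.
move=> /(ge0_ler_powR (ltW a0)); rewrite !nnegrE powR_ge0 => /(_ isT (ltW w0)).
by rewrite -powRrM mulVf ?gt_eqF // powRr1 // ltW.
Qed.

(** * Second-order bounds for real powers *)

(** The second primitive of z |-> z `^ (- m - 1), normalised to vanish to second
    order at 1.  It replaces the remainder of the Taylor expansion at 1 of a
    power, whose second derivative is a multiple of z `^ (a - 2); the choices
    m = -1, 2, 3 make it a rational function. *)
Definition power_kernel (R : realType) (m z : R) : R :=
  (z - 1) / m + (z `^ (1 - m) - 1) / (m * (m - 1)).

Lemma is_derive_remainder (R : realType) (a m t : R) :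
  m != 0 -> m != 1 -> 0 < t ->
  is_derive t 1
    (fun z => z `^ a + a * (1 - z) - a * (a - 1) * power_kernel m z)
    (a * (t `^ (a - 1) - (1 + (1 - a) / m * (t `^ (- m) - 1)))).
Proof.
move=> m0 m1 t0; have m1' : m - 1 != 0 by rewrite subr_eq0.
rewrite (_ : (fun z => _) = fun z => (z `^ a + a * (1 - z))
    - (a * (a - 1)) * (m^-1 * (z - 1) + (m * (m - 1))^-1 * (z `^ (1 - m) - 1))); last first.
  by apply/funext => z; rewrite /power_kernel; field; rewrite ?m0 ?m1'.
have hid : is_derive t 1 (fun z : R => z) 1 := is_derive_id t 1.
have hpow b := is_derive_powR b t0 hid.
have hcst := is_derive_const 1 t.
apply: (is_derive_eq (is_derive_sub
  (is_derive_add (hpow a) (is_derive_scale a (is_derive_sub hcst hid)))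
  (is_derive_scale (a * (a - 1)) (is_derive_add
     (is_derive_scale m^-1 (is_derive_sub hid hcst))
     (is_derive_scale (m * (m - 1))^-1 (is_derive_sub (hpow (1 - m)) hcst)))))).
by rewrite (_ : 1 - m - 1 = - m); [field; rewrite ?m0 ?m1' | ring].
Qed.

Lemma powR_neg_exp (R : realType) (a m t : R) : m != 0 ->
  t `^ (a - 1) = (t `^ (- m)) `^ ((1 - a) / m).
Proof.
by move=> m0; rewrite -powRrM; congr (_ `^ _); field.
Qed.

(** The sign of the derivative of the difference of the two sides is Bernoulli's
    inequality for w = t `^ (- m) with exponent (1 - a) / m. *)
Lemma powR_taylor_le (R : realType) (a m z : R) : m != 0 -> m != 1 ->
  (0 <= a /\ (1 - a) / m <= 0) \/ (a <= 0 /\ 0 <= (1 - a) / m <= 1) ->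
  0 < z <= 1 ->
  z `^ a <= 1 - a * (1 - z) + a * (a - 1) * power_kernel m z.
Proof.
move=> m0 m1 hab z01.
have := le_value_at_one (fun t => is_derive_remainder a m0 m1) _ z01.
rewrite /power_kernel !powR1 !subrr !mul0r addr0 !mulr0 subr0 addr0 => H.
have {}H := H _; suff : z `^ a + a * (1 - z) -
    a * (a - 1) * ((z - 1) / m + (z `^ (1 - m) - 1) / (m * (m - 1))) <= 1 by lra.
apply: H => t /andP[t0 _]; have w0 := powR_gt0 (- m) t0.
rewrite (powR_neg_exp _ _ m0); case: hab => [[a0 b0]|[a0 b01]].
  by rewrite mulr_ge0 // subr_ge0 bernoulli_ge.
by rewrite mulr_le0 // subr_le0 bernoulli_le.
Qed.

Lemma powR_taylor_ge (R : realType) (a m z : R) : m != 0 -> m != 1 ->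
  0 <= a -> 0 <= (1 - a) / m <= 1 -> 0 < z <= 1 ->
  1 - a * (1 - z) + a * (a - 1) * power_kernel m z <= z `^ a.
Proof.
move=> m0 m1 a0 b01 z01.
have hf := fun t (t0 : 0 < t) =>
  is_derive_scale (-1) (is_derive_remainder a m0 m1 t0).
have := le_value_at_one hf _ z01.
rewrite /power_kernel !powR1 !subrr !mul0r addr0 !mulr0 subr0 addr0 => H.
have {}H := H _; suff : -1 * (z `^ a + a * (1 - z) -
    a * (a - 1) * ((z - 1) / m + (z `^ (1 - m) - 1) / (m * (m - 1)))) <= -1 * 1 by lra.
apply: H => t /andP[t0 _]; have w0 := powR_gt0 (- m) t0.
rewrite (powR_neg_exp _ _ m0) mulN1r -mulrN mulr_ge0 // oppr_ge0 subr_le0.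
exact: bernoulli_le.
Qed.

Lemma power_kernelN1 (R : realType) (z : R) : 0 <= z ->
  power_kernel (-1) z = (1 - z) ^+ 2 / 2.
Proof.
move=> z0; rewrite /power_kernel (_ : 1 - -1 = 2%:R); last by ring.
by rewrite powR_mulrn //; field.
Qed.

Lemma power_kernel2 (R : realType) (z : R) : 0 < z ->
  power_kernel 2 z = (1 - z) ^+ 2 / (2 * z).
Proof.
move=> z0; rewrite /power_kernel (_ : 1 - 2 = -1); last by ring.
by rewrite powR_inv1 ?ltW //; field; rewrite gt_eqF.
Qed.

Lemma power_kernel3 (R : realType) (z : R) : 0 < z ->
  power_kernel 3 z = (1 - z) ^+ 2 * (1 + 2 * z) / (6 * z ^+ 2).
Proof.
move=> z0; rewrite /power_kernel (_ : 1 - 3 = - 2%:R); last by ring.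
by rewrite powR_invn ?ltW //; field; rewrite gt_eqF.
Qed.

Lemma powR01_ge (R : realType) (a z : R) : 0 <= a <= 1 -> 0 < z <= 1 ->
  1 - a * (1 - z) - a * (1 - a) * ((1 - z) ^+ 2 / (2 * z)) <= z `^ a.
Proof.
move=> /andP[a0 a1] z01; have /andP[z0 _] := z01.
rewrite -power_kernel2 //.
suff : 1 - a * (1 - z) + a * (a - 1) * power_kernel 2 z <= z `^ a by lra.
apply: powR_taylor_ge => //; lra.
Qed.

Lemma powR12_ge (R : realType) (a z : R) : 1 <= a <= 2 -> 0 < z <= 1 ->
  1 - a * (1 - z) + a * (a - 1) * ((1 - z) ^+ 2 / 2) <= z `^ a.
Proof.
move=> /andP[a1 a2] z01; have /andP[z0 _] := z01.
rewrite -(power_kernelN1 (ltW z0)).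
apply: powR_taylor_ge => //; lra.
Qed.

Lemma powR01_le (R : realType) (a z : R) : 0 <= a <= 1 -> 0 < z <= 1 ->
  z `^ a <= 1 - a * (1 - z) - a * (1 - a) * ((1 - z) ^+ 2 / 2).
Proof.
move=> /andP[a0 a1] z01; have /andP[z0 _] := z01.
rewrite -(power_kernelN1 (ltW z0)).
suff : z `^ a <= 1 - a * (1 - z) + a * (a - 1) * power_kernel (-1) z by lra.
apply: powR_taylor_le => //; lra.
Qed.

Lemma powR12_le (R : realType) (a z : R) : 1 <= a <= 2 -> 0 < z <= 1 ->
  z `^ a <= 1 - a * (1 - z) + a * (a - 1) * ((1 - z) ^+ 2 / (2 * z)).
Proof.
move=> /andP[a1 a2] z01; have /andP[z0 _] := z01.
rewrite -power_kernel2 //.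
apply: powR_taylor_le => //; lra.
Qed.

Lemma powR_neg_le (R : realType) (a z : R) : -2 <= a <= 0 -> 0 < z <= 1 ->
  z `^ a <=
  1 - a * (1 - z) + a * (a - 1) * ((1 - z) ^+ 2 * (1 + 2 * z) / (6 * z ^+ 2)).
Proof.
move=> /andP[a2 a0] z01; have /andP[z0 _] := z01.
rewrite -power_kernel3 //.
apply: powR_taylor_le => //; lra.
Qed.

(** * Positivity of the polynomials in e and u *)

Lemma bernstein_ge0 (R : realType) (i j k l : nat) (e u : R) :
  0 <= e <= 1 -> 0 <= u <= 1 ->
  0 <= e ^+ i * (1 - e) ^+ j * (u ^+ k * (1 - u) ^+ l).
Proof.
by move=> /andP[e0 e1] /andP[u0 u1]; rewrite !mulr_ge0 ?exprn_ge0 ?subr_ge0.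
Qed.

(** Here e = 2 - 1 / r and u = 1 - 2 * q, so that q = (1 - u) / 2, and the first
    factor of the product is the second-order upper bound of q `^ e.  In the
    Bernstein basis of degree (4, 3) in (e, u) all coefficients of the polynomial
    are nonnegative, so lra finds it as a combination of the basis polynomials. *)
Lemma below_bound_light_bottom (R : realType) (e u : R) :
  0 < e <= 1 -> 0 <= u < 1 -> e < 1 \/ 0 < u ->
  0 < (2 - e) ^+ 2 * (1 / 2 + (1 - u))
      - (1 - e * ((1 + u) / 2) - e * (1 - e) * (((1 + u) / 2) ^+ 2 / 2))
        * (3 * (2 - e) + e * (1 - e) * ((1 - u) / 2) - u * (2 - e) ^+ 2).
Proof.
move=> /andP[e0 e1] /andP[u0 u1] eu.
have he : 0 <= e <= 1 by lra.
have hu : 0 <= u <= 1 by lra.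
have B i j := @bernstein_ge0 R i (4 - i) j (3 - j) e u he hu.
(* One basis polynomial with positive coefficient that does not vanish. *)
have pos : 0 < e * (1 - e) ^+ 3 * (1 - u) ^+ 3 \/ 0 < e ^+ 4 * (u * (1 - u) ^+ 2).
  case: eu => h; [left|right]; rewrite !mulr_gt0 ?exprn_gt0 ?subr_gt0 //.
have := B 1%N 0%N; have := B 1%N 1%N; have := B 1%N 2%N.
have := B 2%N 0%N; have := B 2%N 1%N; have := B 2%N 2%N; have := B 2%N 3%N.
have := B 3%N 0%N; have := B 3%N 1%N; have := B 3%N 2%N; have := B 3%N 3%N.
have := B 4%N 1%N; have := B 4%N 2%N; have := B 4%N 3%N.
rewrite !expr0 !expr1 /=.
case: pos => pos; lra.
Qed.

Lemma below_bound_heavy_bottom (R : realType) (e u : R) :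
  0 < e <= 1 -> 0 <= u < 1 -> e < 1 \/ 0 < u ->
  0 < 3 / 2 * (2 - e) ^+ 2
      - (1 - e * ((1 + u) / 2) - e * (1 - e) * (((1 + u) / 2) ^+ 2 / 2))
        * (3 * (2 - e) + e * (1 - e) * ((1 + u) / 2)).
Proof.
move=> /andP[e0 e1] /andP[u0 u1] eu.
have he : 0 <= e <= 1 by lra.
have hu : 0 <= u <= 1 by lra.
have B i j := @bernstein_ge0 R i (4 - i) j (3 - j) e u he hu.
have pos : 0 < e * (1 - e) ^+ 3 * (1 - u) ^+ 3 \/ 0 < e ^+ 4 * (u * (1 - u) ^+ 2).
  case: eu => h; [left|right]; rewrite !mulr_gt0 ?exprn_gt0 ?subr_gt0 //.
have := B 1%N 0%N; have := B 1%N 1%N; have := B 1%N 2%N; have := B 1%N 3%N.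
have := B 2%N 0%N; have := B 2%N 1%N; have := B 2%N 2%N; have := B 2%N 3%N.
have := B 3%N 0%N; have := B 3%N 1%N; have := B 3%N 2%N; have := B 3%N 3%N.
have := B 4%N 1%N; have := B 4%N 2%N; have := B 4%N 3%N.
rewrite !expr0 !expr1 /=.
case: pos => pos; lra.
Qed.

(** The same argument on the range 1 <= e <= 3 / 2, which e = 1 + s / 2 maps to
    the unit interval. *)
Lemma above_bound_heavy_bottom (R : realType) (e u : R) :
  1 <= e <= 3 / 2 -> 0 <= u < 1 -> 1 < e \/ 0 < u ->
  0 < (1 - e * ((1 - u) / 2) + e * (e - 1) * (((1 - u) / 2) ^+ 2 / 2))
        * (3 * (2 - e) - e * (e - 1) * ((1 + u) / 2) + u * (2 - e) ^+ 2)
      - (3 / 2 + u) * (2 - e) ^+ 2.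
Proof.
move=> /andP[e0 e1] /andP[u0 u1] eu.
have [s es] : exists s, e = 1 + s / 2 by exists (2 * (e - 1)); field.
move: e0 e1 eu; rewrite {e}es => e0 e1 eu.
have hs : 0 <= s <= 1 by lra.
have hu : 0 <= u <= 1 by lra.
have B i j := @bernstein_ge0 R i (4 - i) j (3 - j) s u hs hu.
have pos : [\/ 0 < s * (1 - s) ^+ 3 * (1 - u) ^+ 3, 0 < s ^+ 4 * (1 - u) ^+ 3
             | 0 < (1 - s) ^+ 4 * (u * (1 - u) ^+ 2)].
  have [s1|s1] := ltP s 1; last first.
    by apply: Or32; rewrite mulr_gt0 ?exprn_gt0 //; lra.
  have [s0|s0] := ltP 0 s.
    by apply: Or31; rewrite !mulr_gt0 ?exprn_gt0 //; lra.
  apply: Or33; rewrite !mulr_gt0 ?exprn_gt0 //; lra.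
have := B 0%N 1%N; have := B 0%N 2%N; have := B 0%N 3%N.
have := B 1%N 0%N; have := B 1%N 1%N; have := B 1%N 2%N; have := B 1%N 3%N.
have := B 2%N 0%N; have := B 2%N 1%N; have := B 2%N 2%N; have := B 2%N 3%N.
have := B 3%N 0%N; have := B 3%N 1%N; have := B 3%N 2%N; have := B 3%N 3%N.
have := B 4%N 0%N; have := B 4%N 1%N; have := B 4%N 2%N; have := B 4%N 3%N.
rewrite !expr0 !expr1 /=.
case: pos => pos; lra.
Qed.

(** * Second-order conditions *)

(** The variable e = 2 - 1 / r, the exponent of the factor c, makes all the
    conditions on r polynomial. *)
Lemma exponent_substitution (R : realType) (r : R) : 1 / 2 < r ->
  exists2 e, 2 - 1 / r = e & 0 < e < 2 /\ r = (2 - e)^-1.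
Proof.
move=> r2; have r0 : 0 < r by lra.
have i0 : 0 < 1 / r by rewrite divr_gt0.
have i2 : 1 / r < 2 by rewrite ltr_pdivrMr //; lra.
exists (2 - 1 / r) => //; split; first lra.
by rewrite opprB addrC subrK div1r invrK.
Qed.

(** These are the conditions under which the second-order expansions in
    two_point_below add up to something positive.  They are affine in S, so it
    suffices to treat S = q and S = 1 - q (the value at S = 1 / 2 being at least
    the one at S = 1 - q); there, bounding c by its second-order expansion in
    1 - q leaves the two polynomials above. *)
Lemma second_order_below (R : realType) (r q S : R) :
  1 / 2 < r <= 1 -> 0 < q <= 1 / 2 -> r < 1 \/ q < 1 / 2 -> q <= S <= 1 - q ->
  let c := q `^ (2 - 1 / r) in
  [/\ 0 <= c <= 1, 0 < 3 * (1 / 2 - r * c) - c * (1 - r) * (2 * r - 1) * S &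
      S <= 1 / 2 -> 0 < 3 * (1 / 2 - r * c) - c * (1 - r) * (2 * r - 1) * S
                        - (1 - c) * (1 - 2 * S)].
Proof.
move=> /andP[r2 r1] /andP[q0 q2] rq /andP[qS Sq] c.
have [e ee [/andP[e0 e2] re]] := exponent_substitution r2.
have e1 : e <= 1.
  by move: r1; rewrite re invf_le1; lra.
have e01 : 0 <= e <= 1 by lra.
have q01 : 0 < q <= 1 by lra.
have eu : e < 1 \/ 0 < 1 - 2 * q.
  case: rq => [r1'|]; [left|right; lra].
  by move: r1'; rewrite re invf_lt1; lra.
have c0 : 0 <= c := powR_ge0 _ _.
have U0 : 0 <= c * (1 - r) * (2 * r - 1) by rewrite !mulr_ge0; lra.
have c1 : c <= 1.
  by rewrite -(powRr0 q); apply: ger_powR => //; rewrite ee ltW.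
have cC : c <= _ := powR01_le (_ : 0 <= 2 - 1 / r <= 1) q01.
rewrite ee in cC; have {}cC := cC e01.
have u01 : 0 <= 1 - 2 * q < 1 by lra.
have e01' : 0 < e <= 1 by lra.
have t0 : 0 < 2 - e by lra.
have qe0 : 0 <= e * (1 - e) by rewrite mulr_ge0; lra.
have qt0 : 0 <= q * (2 - e) by rewrite mulr_ge0; lra.
have k3 : 0 <= 3 * (2 - e) + e * (1 - e) * (1 - q).
  by rewrite addr_ge0 ?mulr_ge0 //; lra.
have k1 : 0 <= 3 * (2 - e) + e * (1 - e) * q - (1 - 2 * q) * (2 - e) ^+ 2.
  have -> : 3 * (2 - e) + e * (1 - e) * q - (1 - 2 * q) * (2 - e) ^+ 2 =
    e * (1 - e) * q + (2 - e) * (1 + e + 2 * (q * (2 - e))) by ring.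
  by apply: addr_ge0; apply: mulr_ge0; lra.
have hlight := below_bound_light_bottom e01' u01 eu.
have hheavy := below_bound_heavy_bottom e01' u01 eu.
rewrite (_ : (1 + (1 - 2 * q)) / 2 = 1 - q) in hlight hheavy; last by field.
rewrite (_ : (1 - (1 - 2 * q)) / 2 = q) in hlight; last by field.
set C := (X in c <= X) in cC; rewrite -/C in hlight hheavy.
have h3 := ler_wpM2r k3 cC; have h1 := ler_wpM2r k1 cC.
have split3 s : 3 * (1 / 2 - r * c) - c * (1 - r) * (2 * r - 1) * s =
  (3 / 2 * (2 - e) ^+ 2 - c * (3 * (2 - e) + e * (1 - e) * s)) / (2 - e) ^+ 2.
  by rewrite re; field; rewrite gt_eqF.
have P3 : 0 < 3 * (1 / 2 - r * c) - c * (1 - r) * (2 * r - 1) * (1 - q).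
  by rewrite split3 divr_gt0 ?exprn_gt0 //; lra.
have P1 : 0 < 3 * (1 / 2 - r * c) - c * (1 - r) * (2 * r - 1) * q
              - (1 - c) * (1 - 2 * q).
  rewrite split3 -(pmulr_lgt0 _ (exprn_gt0 2 t0)) mulrBl divfK ?expf_neq0 ?gt_eqF //.
  lra.
have P2 : 0 < 3 * (1 / 2 - r * c) - c * (1 - r) * (2 * r - 1) * S.
  have := ler_wpM2l U0 Sq; lra.
split => //; first by rewrite c0.
move=> S2; set U := c * (1 - r) * (2 * r - 1) in P1 P2 P3 U0 *.
clearbody U; clear -U0 P1 P2 P3 qS Sq S2 q0 q2.
have [qS'|qS'] := eqVneq q S; first by rewrite -qS'.
have {}qS : q < S by rewrite lt_neqAle qS' qS.
have P2' : 0 < 3 * (1 / 2 - r * c) - U / 2.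
  by have := ler_wpM2l U0 (_ : 1 / 2 <= 1 - q); lra.
rewrite -(pmulr_rgt0 _ (_ : 0 < 1 / 2 - q)); last lra.
have -> : (1 / 2 - q) * (3 * (1 / 2 - r * c) - U * S - (1 - c) * (1 - 2 * S)) =
  (1 / 2 - S) * (3 * (1 / 2 - r * c) - U * q - (1 - c) * (1 - 2 * q)) +
  (S - q) * (3 * (1 / 2 - r * c) - U / 2) by field.
by rewrite ltr_wpDl ?mulr_ge0 ?mulr_gt0 //; lra.
Qed.

(** The second condition is affine in S on [1 / 2, 1 - q], and its value at
    S = 1 - q is the worst one; it also implies the first condition. *)
Lemma second_order_above (R : realType) (r q S : R) :
  1 <= r <= 2 -> 0 < q <= 1 / 2 -> 1 < r \/ q < 1 / 2 -> 0 <= S <= 1 - q ->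
  let c := (1 - q) `^ (2 - 1 / r) in
  [/\ 0 <= c <= 1, 0 < 3 * (r * c - 1 / 2) - c * (r - 1) * (2 * r - 1) * S &
      1 / 2 <= S -> 0 < 3 * (r * c - 1 / 2) - c * (r - 1) * (2 * r - 1) * S
                        - (1 - c) * (2 * S - 1)].
Proof.
move=> /andP[r1 r2] /andP[q0 q2] rq /andP[S0 Sq] c.
have [|e ee [/andP[e0 e2] re]] := @exponent_substitution _ r; first lra.
have r0 : 0 < r by lra.
have e1 : 1 <= e by rewrite -ee lerBrDl -lerBrDr ler_pdivrMr //; lra.
have e3 : e <= 3 / 2 by rewrite -ee lerBlDr -lerBlDl ler_pdivlMr //; lra.
have eu : 1 < e \/ 0 < 1 - 2 * q.
  case: rq => [r1'|]; [left|right; lra].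
  by rewrite -ee ltrBrDl -ltrBrDr ltr_pdivrMr //; lra.
have z01 : 0 < 1 - q <= 1 by lra.
have c0 : 0 <= c := powR_ge0 _ _.
have U0 : 0 <= c * (r - 1) * (2 * r - 1) by rewrite !mulr_ge0 //; lra.
have c1 : c <= 1.
  rewrite -(powRr0 (1 - q)); apply: ger_powR => //.
  by rewrite ee ltW.
have e13 : 1 <= e <= 3 / 2 by rewrite e1.
have e12 : 1 <= e <= 2 by lra.
have u01 : 0 <= 1 - 2 * q < 1 by lra.
have k1 : 0 <= 3 * (2 - e) - e * (e - 1) * (1 - q) + (1 - 2 * q) * (2 - e) ^+ 2.
  have h1 : 0 <= e * (e - 1) * q by rewrite !mulr_ge0 //; lra.
  have h2 : 0 <= (1 - 2 * q) * (2 - e) ^+ 2 by rewrite mulr_ge0 ?sqr_ge0 //; lra.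
  have h3 : 0 <= (3 / 2 - e) * (e + 7 / 2) by rewrite mulr_ge0 //; lra.
  lra.
have hheavy := above_bound_heavy_bottom e13 u01 eu.
rewrite (_ : (1 + (1 - 2 * q)) / 2 = 1 - q) in hheavy; last by field.
rewrite (_ : (1 - (1 - 2 * q)) / 2 = q) in hheavy; last by field.
have cC := powR12_ge e12 z01.
rewrite (_ : 1 - (1 - q) = q) in cC; last by ring.
rewrite -[in leRHS]ee -/c in cC.
set C := (X in X <= c) in cC; rewrite -/C in hheavy.
have h1 := ler_wpM2r k1 cC.
have P1 : 0 < 3 * (r * c - 1 / 2) - c * (r - 1) * (2 * r - 1) * (1 - q)
              - (1 - c) * (1 - 2 * q).
  have t0 : 0 < 2 - e by lra.
  have -> : 3 * (r * c - 1 / 2) - c * (r - 1) * (2 * r - 1) * (1 - q)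
              - (1 - c) * (1 - 2 * q) =
    (c * (3 * (2 - e) - e * (e - 1) * (1 - q) + (1 - 2 * q) * (2 - e) ^+ 2)
     - (3 / 2 + (1 - 2 * q)) * (2 - e) ^+ 2) / (2 - e) ^+ 2.
    by rewrite re; field; rewrite gt_eqF.
  rewrite divr_gt0 ?exprn_gt0 //.
  exact: lt_le_trans hheavy (lerB h1 (lexx _)).
have G0 : 0 <= 1 - c by rewrite subr_ge0.
clear - U0 Sq S0 P1 G0 c0 c1 q2.
move: U0 P1; set U := c * (r - 1) * (2 * r - 1); set T := r * c - 1 / 2.
move=> U0 P1; have hS := ler_wpM2l U0 Sq; have hG := ler_wpM2l G0 Sq.
split; first by rewrite c0.
  have : 0 <= (1 - c) * (1 - 2 * q) by rewrite mulr_ge0 //; lra.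
  lra.
lra.
Qed.

(** * Two values *)

(** The slope of the gap for a mass S at y ^+ 2 and a mass 1 - S at 1.  Its
    terms of order 0 and 1 in 1 - y cancel; after division by
    S * (1 - y) ^+ 2 / y, second-order lower bounds of both powers leave the
    expressions of second_order_below. *)
Lemma two_point_below (R : realType) (r q S y c m : R) :
  1 / 2 < r <= 1 -> 0 < q <= 1 / 2 -> r < 1 \/ q < 1 / 2 -> q <= S <= 1 - q ->
  0 < y < 1 ->
  c = q `^ (2 - 1 / r) -> m = 1 - S * (1 - y) ->
  0 < (1 / 2 - r * c) * (S * (1 - y ^+ 2) / y ^+ 2) + c * m `^ (2 - 2 * r)
      + (1 - c) * y `^ (2 * S) - m.
Proof.
move=> r01 q01 rq qS yb ec em; have /andP[y0 y1] := yb.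
have [/andP[c0 c1] P1 P2] := second_order_below r01 q01 rq qS.
rewrite -ec in c0 c1 P1 P2.
have S0 : 0 < S by lra.
have S1 : S < 1 by lra.
have d0 : 0 < 1 - y by lra.
have ym : y <= m.
  by have := ler_wpM2r (ltW d0) (ltW S1); rewrite em; lra.
have m01 : 0 < m <= 1.
  by have := mulr_gt0 S0 d0; rewrite (lt_le_trans y0 ym) /= em; lra.
have y01 : 0 < y <= 1 by lra.
have m0 : 0 < m by case/andP: m01.
have th01 : 0 <= 2 - 2 * r <= 1 by lra.
have hm := ler_wpM2l c0 (powR01_ge th01 m01).
set U := c * (1 - r) * (2 * r - 1) in P1 P2.
have U0 : 0 <= U by rewrite !mulr_ge0 //; lra.
have T0 : 0 < 1 / 2 - r * c by have := mulr_ge0 U0 (ltW S0); lra.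
have c1' : 0 <= 1 - c by rewrite subr_ge0.
have hT : 3 * (1 / 2 - r * c) <= (1 / 2 - r * c) * ((1 + 2 * y) / y).
  rewrite mulrC ler_wpM2l ?(ltW T0) // ler_pdivlMr //; lra.
have hU : U * S * (y / m) <= U * S.
  apply: ler_piMr; first by rewrite mulr_ge0 ?(ltW S0).
  by rewrite ler_pdivrMr // mul1r.
have reduce k : 1 - 2 * S * (1 - y) - 2 * S * (1 - 2 * S) * ((1 - y) ^+ 2 / 2 * k)
      <= y `^ (2 * S) ->
    0 < (1 / 2 - r * c) * ((1 + 2 * y) / y) - U * S * (y / m)
        - (1 - c) * (1 - 2 * S) * (k * y) ->
  0 < (1 / 2 - r * c) * (S * (1 - y ^+ 2) / y ^+ 2) + c * m `^ (2 - 2 * r)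
      + (1 - c) * y `^ (2 * S) - m.
  move=> /(ler_wpM2l c1') hy pos.
  have := mulr_gt0 (divr_gt0 (mulr_gt0 S0 (exprn_gt0 2 d0)) y0) pos.
  have -> : S * (1 - y) ^+ 2 / y *
    ((1 / 2 - r * c) * ((1 + 2 * y) / y) - U * S * (y / m)
        - (1 - c) * (1 - 2 * S) * (k * y)) =
    (1 / 2 - r * c) * (S * (1 - y ^+ 2) / y ^+ 2)
    + c * (1 - (2 - 2 * r) * (1 - m)
           - (2 - 2 * r) * (1 - (2 - 2 * r)) * ((1 - m) ^+ 2 / (2 * m)))
    + (1 - c) * (1 - 2 * S * (1 - y)
                 - 2 * S * (1 - 2 * S) * ((1 - y) ^+ 2 / 2 * k)) - m.
    by rewrite /U; move: m0; rewrite em => m0; field; rewrite !gt_eqF.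
  clear -hm hy; lra.
(* The remainder of y `^ (2 * S) is negative for 2 * S < 1, where its lower bound
   needs the larger kernel with 1 / y, and positive for 2 * S > 1. *)
have [S2|/ltW S2] := leP S (1 / 2).
  have s01 : 0 <= 2 * S <= 1 by lra.
  apply: (reduce y^-1).
    rewrite (_ : (1 - y) ^+ 2 / 2 * y^-1 = (1 - y) ^+ 2 / (2 * y)).
      exact: powR01_ge.
    by field; rewrite gt_eqF.
  rewrite mulVf ?gt_eqF // mulr1; have := P2 S2; clear -hT hU; lra.
have s12 : 1 <= 2 * S <= 2 by lra.
apply: (reduce 1).
  by have := powR12_ge s12 y01; clear; lra.
have : 0 <= (1 - c) * (2 * S - 1) * y.
  by rewrite !mulr_ge0 ?(ltW y0) //; lra.
clear -hT hU P1; lra.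
Qed.

(** The power of m now has a negative exponent, hence the kernel
    (1 + 2 * m) / m ^+ 2, which decreases in m and is compared with
    (1 + 2 * y) / y ^+ 2, the factor carried by the variance term. *)
Lemma two_point_above (R : realType) (r q S y c m : R) :
  1 <= r <= 2 -> 0 < q <= 1 / 2 -> 1 < r \/ q < 1 / 2 -> q <= S <= 1 - q ->
  0 < y < 1 ->
  c = (1 - q) `^ (2 - 1 / r) -> m = 1 - S * (1 - y) ->
  (1 / 2 - r * c) * (S * (1 - y ^+ 2) / y ^+ 2) + c * m `^ (2 - 2 * r)
      + (1 - c) * y `^ (2 * S) - m < 0.
Proof.
move=> r12 q01 rq qS yb ec em; have /andP[y0 y1] := yb.
have S0q : 0 <= S <= 1 - q by lra.
have [/andP[c0 c1] P1 P2] := second_order_above r12 q01 rq S0q.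
rewrite -ec in c0 c1 P1 P2.
have S0 : 0 < S by lra.
have S1 : S < 1 by lra.
have d0 : 0 < 1 - y by lra.
have ym : y <= m.
  by have := ler_wpM2r (ltW d0) (ltW S1); rewrite em; lra.
have m01 : 0 < m <= 1.
  by have := mulr_gt0 S0 d0; rewrite (lt_le_trans y0 ym) /= em; lra.
have y01 : 0 < y <= 1 by lra.
have m0 : 0 < m by case/andP: m01.
have th01 : - 2 <= 2 - 2 * r <= 0 by lra.
have hm := ler_wpM2l c0 (powR_neg_le th01 m01).
set U := c * (r - 1) * (2 * r - 1) in P1 P2.
have U0 : 0 <= U by rewrite !mulr_ge0 //; lra.
have c1' : 0 <= 1 - c by rewrite subr_ge0.
pose K := (1 + 2 * y) / (3 * y ^+ 2).
have K0 : 0 < K by rewrite divr_gt0 ?mulr_gt0 ?exprn_gt0 //; lra.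
have hU : U * S * ((1 + 2 * m) / (3 * m ^+ 2)) <= U * S * K.
  apply: ler_wpM2l; first by rewrite mulr_ge0 ?(ltW S0).
  have -> : (1 + 2 * m) / (3 * m ^+ 2) = (m^-1 ^+ 2 + 2 * m^-1) / 3.
    by field; rewrite gt_eqF.
  have -> : K = (y^-1 ^+ 2 + 2 * y^-1) / 3 by rewrite /K; field; rewrite gt_eqF.
  have mi : m^-1 <= y^-1 by rewrite lef_pV2.
  have mi0 : 0 <= m^-1 by rewrite invr_ge0 ltW.
  have := lerXn2r 2 _ _ mi; rewrite !nnegrE mi0 (le_trans mi0 mi) => /(_ isT isT).
  clear -mi; lra.
have reduce k : y `^ (2 * S) <=
      1 - 2 * S * (1 - y) - 2 * S * (1 - 2 * S) * ((1 - y) ^+ 2 / 2 * k) ->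
    (1 - c) * (2 * S - 1) * k < K * (3 * (r * c - 1 / 2) - U * S) ->
  (1 / 2 - r * c) * (S * (1 - y ^+ 2) / y ^+ 2) + c * m `^ (2 - 2 * r)
      + (1 - c) * y `^ (2 * S) - m < 0.
  move=> /(ler_wpM2l c1') hy pos.
  have {}pos : 0 < 3 * K * (r * c - 1 / 2)
     - U * S * ((1 + 2 * m) / (3 * m ^+ 2)) - (1 - c) * (2 * S - 1) * k.
    clear -pos hU; lra.
  have := mulr_gt0 (mulr_gt0 S0 (exprn_gt0 2 d0)) pos.
  have -> : S * (1 - y) ^+ 2 * (3 * K * (r * c - 1 / 2)
     - U * S * ((1 + 2 * m) / (3 * m ^+ 2)) - (1 - c) * (2 * S - 1) * k) =
    - ((1 / 2 - r * c) * (S * (1 - y ^+ 2) / y ^+ 2)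
    + c * (1 - (2 - 2 * r) * (1 - m)
           + (2 - 2 * r) * (2 - 2 * r - 1) * ((1 - m) ^+ 2 * (1 + 2 * m) / (6 * m ^+ 2)))
    + (1 - c) * (1 - 2 * S * (1 - y)
                 - 2 * S * (1 - 2 * S) * ((1 - y) ^+ 2 / 2 * k)) - m).
    by rewrite /U /K; move: m0; rewrite em => m0; field; rewrite !gt_eqF.
  clear -hm hy; lra.
have [S2|/ltW S2] := leP S (1 / 2).
  have s01 : 0 <= 2 * S <= 1 by lra.
  apply: (reduce 1); first by have := powR01_le s01 y01; clear; lra.
  have := mulr_gt0 K0 P1.
  have : 0 <= (1 - c) * (1 - 2 * S) by rewrite mulr_ge0 //; lra.
  clear; lra.
have s12 : 1 <= 2 * S <= 2 by lra.
apply: (reduce y^-1).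
  rewrite (_ : (1 - y) ^+ 2 / 2 * y^-1 = (1 - y) ^+ 2 / (2 * y)).
    by have := powR12_le s12 y01; clear; lra.
  by field; rewrite gt_eqF.
have yK : y^-1 <= K.
  rewrite /K ler_pdivlMr ?mulr_gt0 ?exprn_gt0 //.
  rewrite (_ : y^-1 * (3 * y ^+ 2) = 3 * y); last by field; rewrite gt_eqF.
  lra.
have G0 : 0 <= (1 - c) * (2 * S - 1) by rewrite mulr_ge0 //; lra.
apply: (le_lt_trans (ler_wpM2l G0 yK)).
have := mulr_gt0 K0 (P2 S2); clear; lra.
Qed.

(** * Reduction to two values *)

Lemma inv_sqr_tangent (R : realType) (a b : R) : 0 < a -> 0 < b ->
  (1 - b ^+ 2) / b ^+ 2 - 2 * (a - b) / b ^+ 3 <= (1 - a ^+ 2) / a ^+ 2.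
Proof.
move=> a0 b0; rewrite -subr_ge0.
have -> : (1 - a ^+ 2) / a ^+ 2 - ((1 - b ^+ 2) / b ^+ 2 - 2 * (a - b) / b ^+ 3) =
  (a - b) ^+ 2 * (b + 2 * a) / (a ^+ 2 * b ^+ 3).
  by field; rewrite !gt_eqF.
rewrite divr_ge0 // mulr_ge0 ?sqr_ge0 //; last by rewrite exprn_ge0 ?ltW.
by lra.
Qed.

Lemma ln_tangent (R : realType) (a b : R) : 0 < a -> 0 < b ->
  ln a <= ln b + (a - b) / b.
Proof.
move=> a0 b0; have := ln_le_sub1 (divr_gt0 a0 b0).
by rewrite ln_div ?posrE // mulrBl divff ?gt_eqF // lerBlDl.
Qed.

Lemma ln_chord (R : realType) (a b : R) : 0 < a < 1 -> a <= b <= 1 ->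
  (1 - b) / (1 - a) * ln a <= ln b.
Proof.
move=> /andP[a0 a1] /andP[ab b1]; have b0 : 0 < b := lt_le_trans a0 ab.
have d0 : 0 < 1 - a by lra.
have ha := ln_tangent a0 b0; have h1 := ln_tangent ltr01 b0.
rewrite ln1 in h1.
have l0 : 0 <= (1 - b) / (1 - a) by rewrite divr_ge0 //; lra.
have l1 : 0 <= (b - a) / (1 - a) by rewrite divr_ge0 //; lra.
have := lerD (ler_wpM2l l0 ha) (ler_wpM2l l1 h1).
rewrite mulr0 addr0 => /le_trans; apply.
rewrite [leLHS](_ : _ = ln b) //.
by field; rewrite !gt_eqF.
Qed.

Lemma jensen_powR (R : realType) (I : finType) (w y : I -> R) (a : R) :
  1 <= a -> (forall i, 0 <= w i) -> \sum_i w i = 1 -> (forall i, 0 < y i) ->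
  0 < \sum_i w i * y i ->
  (\sum_i w i * y i) `^ a <= \sum_i w i * y i `^ a.
Proof.
move=> a1 w0 w1 y0; set m := \sum_i _ => m0.
have -> : m `^ a = \sum_i w i * (m `^ a * (1 + a * (y i / m - 1))).
  transitivity (\sum_i (m `^ a * (1 - a) * w i + m `^ a * a / m * (w i * y i))).
    rewrite big_split /= -!mulr_sumr w1 -/m; field; rewrite gt_eqF //.
  by apply: eq_bigr => i _; field; rewrite gt_eqF.
apply: ler_sum => i _; apply: ler_wpM2l => //.
have -> : y i `^ a = m `^ a * (y i / m) `^ a.
  rewrite -powRM ?ltW ?divr_gt0 //; congr (_ `^ _); field; rewrite gt_eqF //.
by rewrite ler_wpM2l ?powR_ge0 // bernoulli_ge1 ?divr_gt0.
Qed.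

(** Each y i splits its weight between y i0 and 1 without changing the mean m:
    the part (1 - y i) / (1 - y i0) goes to y i0.  Concavity of ln and convexity
    of the square show that the other two terms only decrease, so the claim
    reduces to two_point_below with S the total mass sent to y i0. *)
Lemma slope_below (R : realType) (I : finType) (w y : I -> R) (i0 i1 : I)
    (r q c m : R) :
  1 / 2 < r <= 1 -> 0 < q <= 1 / 2 -> r < 1 \/ q < 1 / 2 ->
  (forall i, q <= w i) -> \sum_i w i = 1 ->
  0 < y i0 < 1 -> (forall i, y i0 <= y i <= 1) -> y i1 = 1 ->
  c = q `^ (2 - 1 / r) -> m = \sum_i w i * y i ->
  0 < (1 / 2 - r * c) * (\sum_i w i * (1 - y i ^+ 2) / y i0 ^+ 2)
      + c * m `^ (2 - 2 * r) + (1 - c) * expR (2 * \sum_i w i * ln (y i)) - m.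
Proof.
move=> r01 q01 rq qw w1 y01 yb yi1 ec em; have /andP[y0 y1] := y01.
have d0 : 0 < 1 - y i0 by rewrite subr_gt0.
have w0 i : 0 <= w i by apply: le_trans (qw i); case/andP: q01 => /ltW.
(* The mass sent to y i0. *)
pose S := (1 - m) / (1 - y i0).
have mE : 1 - m = \sum_i w i * (1 - y i).
  rewrite em -{1}w1 -sumrB; apply: eq_bigr => i _; ring.
have qS : q <= S.
  rewrite /S ler_pdivlMr // mE (bigD1 i0) //=.
  rewrite ler_wpDr ?ler_wpM2r ?(ltW d0) // sumr_ge0 // => i _.
  by rewrite mulr_ge0 // subr_ge0; case/andP: (yb i).
have Sq : S <= 1 - q.
  rewrite /S ler_pdivrMr // mE (bigD1 i1) //= yi1 subrr mulr0 add0r.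
  apply: (@le_trans _ _ (\sum_(i | i != i1) w i * (1 - y i0))).
    apply: ler_sum => i _; apply: ler_wpM2l => //.
    by rewrite lerD2l lerN2; case/andP: (yb i).
  rewrite -mulr_suml; apply: ler_wpM2r; first exact: ltW.
  by have := qw i1; move: w1; rewrite (bigD1 i1) //=; lra.
have SqS : q <= S <= 1 - q by rewrite qS.
have mS : m = 1 - S * (1 - y i0) by rewrite /S; field; rewrite gt_eqF.
have Sdef : S = (1 - m) / (1 - y i0) by [].
clearbody S; have := two_point_below r01 q01 rq SqS y01 ec mS.
have [/andP[c0 c1] P1 _] := second_order_below r01 q01 rq SqS.
rewrite -ec in c0 c1 P1.
have T0 : 0 <= 1 / 2 - r * c.
  suff : 0 <= c * (1 - r) * (2 * r - 1) * S by lra.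
  by rewrite !mulr_ge0 //; lra.
have hK : S * (1 - y i0 ^+ 2) / y i0 ^+ 2 <=
          \sum_i w i * (1 - y i ^+ 2) / y i0 ^+ 2.
  rewrite -mulr_suml ler_wpM2r ?invr_ge0 ?sqr_ge0 //.
  have -> : S * (1 - y i0 ^+ 2) = \sum_i w i * (1 - y i) * (1 + y i0).
    by rewrite -mulr_suml -mE Sdef; field; rewrite gt_eqF.
  apply: ler_sum => i _; have /andP[yi yi'] := yb i.
  rewrite -mulrA; apply: ler_wpM2l => //.
  rewrite (_ : 1 - y i ^+ 2 = (1 - y i) * (1 + y i)); last by ring.
  by rewrite ler_wpM2l ?lerD2l // subr_ge0.
have hG : y i0 `^ (2 * S) <= expR (2 * \sum_i w i * ln (y i)).
  rewrite /powR gt_eqF // ler_expR -mulrA ler_wpM2l //.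
  have -> : S * ln (y i0) = \sum_i w i * ((1 - y i) / (1 - y i0) * ln (y i0)).
    rewrite Sdef mE !mulr_suml; apply: eq_bigr => i _; ring.
  by apply: ler_sum => i _; apply: ler_wpM2l => //; apply: ln_chord.
have c1' : 0 <= 1 - c by rewrite subr_ge0.
have := ler_wpM2l T0 hK; have := ler_wpM2l c1' hG; clear; lra.
Qed.

(** All indices other than i1 are merged at their mean b, which keeps m.  By
    convexity of 1 / y ^+ 2 the variance term is at least its value after
    merging, and by concavity of ln the geometric mean is at most its value
    after merging, so the claim reduces to two_point_above. *)
Lemma slope_above (R : realType) (I : finType) (w y : I -> R) (i0 i1 : I)
    (r q c m : R) :
  1 <= r <= 2 -> 0 < q <= 1 / 2 -> 1 < r \/ q < 1 / 2 ->
  (forall i, q <= w i) -> \sum_i w i = 1 ->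
  0 < y i0 < 1 -> (forall i, y i0 <= y i <= 1) -> y i1 = 1 ->
  c = (1 - q) `^ (2 - 1 / r) -> m = \sum_i w i * y i ->
  (1 / 2 - r * c) * (\sum_i w i * (1 - y i ^+ 2) / y i0 ^+ 2)
      + c * m `^ (2 - 2 * r) + (1 - c) * expR (2 * \sum_i w i * ln (y i)) - m < 0.
Proof.
move=> r12 q01 rq qw w1 y01 yb yi1 ec em; have /andP[y0 y1] := y01.
have q0 : 0 < q by case/andP: q01.
have wgt0 i : 0 < w i := lt_le_trans q0 (qw i).
have i01 : i0 != i1 by apply/eqP => e; move: y1; rewrite e yi1 ltxx.
have ygt0 i : 0 < y i by apply: lt_le_trans y0 _; case/andP: (yb i).
pose S := \sum_(i | i != i1) w i.
have SE : w i1 + S = 1 by rewrite -w1 (bigD1 i1).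
have qS : q <= S.
  rewrite /S (bigD1 i0) //= (le_trans (qw i0)) // lerDl sumr_ge0 // => i _.
  exact: ltW.
have Sq : S <= 1 - q by have := qw i1; lra.
have S0 : 0 < S := lt_le_trans q0 qS.
have SqS : q <= S <= 1 - q by rewrite qS.
pose b := (\sum_(i | i != i1) w i * y i) / S.
have bE : \sum_(i | i != i1) w i * y i = S * b by rewrite /b; field; rewrite gt_eqF.
have b0 : 0 < b.
  rewrite divr_gt0 // (bigD1 i0) //= ltr_wpDr ?mulr_gt0 // sumr_ge0 // => i _.
  by rewrite mulr_ge0 ?ltW.
have b1 : b < 1.
  rewrite /b ltr_pdivrMr // mul1r /S !(bigD1 i0 i01) /= ltr_leD //.
    by rewrite gtr_pMr.
  apply: ler_sum => i _; apply: ler_piMr; first exact: ltW.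
  by case/andP: (yb i).
have b01 : 0 < b < 1 by rewrite b0.
have mS : m = 1 - S * (1 - b).
  rewrite em (bigD1 i1) //= yi1 bE; move: SE; clear; lra.
have := two_point_above r12 q01 rq SqS b01 ec mS.
have S0' : 0 <= S <= 1 - q by rewrite ltW.
have [/andP[c0 c1] P1 _] := second_order_above r12 q01 rq S0'.
rewrite -ec in c0 c1 P1.
have T0 : 0 <= r * c - 1 / 2.
  suff : 0 <= c * (r - 1) * (2 * r - 1) * S by lra.
  by rewrite !mulr_ge0 ?(ltW S0) //; lra.
have hK : S * (1 - b ^+ 2) / b ^+ 2 <=
          \sum_i w i * (1 - y i ^+ 2) / y i0 ^+ 2.
  rewrite (bigD1 i1) //= yi1 expr1n subrr mulr0 mul0r add0r.
  apply: (@le_trans _ _ (\sum_(i | i != i1)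
    w i * ((1 - b ^+ 2) / b ^+ 2 - 2 * (y i - b) / b ^+ 3))).
    have -> : \sum_(i | i != i1)
        w i * ((1 - b ^+ 2) / b ^+ 2 - 2 * (y i - b) / b ^+ 3) =
      \sum_(i | i != i1) (((1 - b ^+ 2) / b ^+ 2 + 2 / b ^+ 2) * w i
                          - 2 / b ^+ 3 * (w i * y i)).
      by apply: eq_bigr => i _; field; rewrite gt_eqF.
    rewrite sumrB -!mulr_sumr bE -/S le_eqVlt; apply/orP; left; apply/eqP.
    by field; rewrite gt_eqF.
  apply: ler_sum => i _; rewrite -[leRHS]mulrA; apply: ler_wpM2l; first exact: ltW.
  apply: le_trans (inv_sqr_tangent (ygt0 i) b0) _.
  have /andP[yi yi'] := yb i.
  have h0 : 0 <= 1 - y i ^+ 2 by rewrite subr_ge0 exprn_ile1 // ltW.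
  apply: ler_wpM2l => //; rewrite lef_pV2 ?posrE ?exprn_gt0 //.
  by rewrite lerXn2r ?nnegrE ?(ltW y0) ?(ltW (ygt0 i)).
have hG : expR (2 * \sum_i w i * ln (y i)) <= b `^ (2 * S).
  rewrite /powR gt_eqF // ler_expR -mulrA ler_wpM2l //.
  rewrite (bigD1 i1) //= yi1 ln1 mulr0 add0r.
  apply: (@le_trans _ _ (\sum_(i | i != i1) w i * (ln b + (y i - b) / b))).
    by apply: ler_sum => i _; apply: ler_wpM2l; [exact: ltW|exact: ln_tangent].
  have -> : \sum_(i | i != i1) w i * (ln b + (y i - b) / b) =
    \sum_(i | i != i1) ((ln b - 1) * w i + b^-1 * (w i * y i)).
    by apply: eq_bigr => i _; field; rewrite gt_eqF.
  rewrite big_split /= -!mulr_sumr bE -/S le_eqVlt; apply/orP; left; apply/eqP.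
  by field; rewrite gt_eqF.
have c1' : 0 <= 1 - c by rewrite subr_ge0.
have := ler_wpM2l T0 hK; have := ler_wpM2l c1' hG; clear; lra.
Qed.

(** * The slope of the gap *)

Lemma power_mean_homogeneous (R : realType) (I : finType) (w y : I -> R) (r s : R) :
  1 / 2 < r -> (forall i, 0 <= w i) -> 0 < s -> (forall i, 0 < y i) ->
  0 < \sum_i w i * y i `^ (2 * r) ->
  (\sum_i w i * (s * y i ^+ 2) `^ r) `^ (1 / r - 1) * s `^ (r - 1) =
  (\sum_i w i * y i `^ (2 * r)) `^ (1 / r - 1).
Proof.
move=> r2 w0 s0 y0; set Q := \sum_i w i * y i `^ _ => Q0.
have rn0 : r != 0 by rewrite gt_eqF //; lra.
have -> : \sum_i w i * (s * y i ^+ 2) `^ r = s `^ r * Q.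
  rewrite mulr_sumr; apply: eq_bigr => i _.
  rewrite powRM ?ltW ?exprn_gt0 // -powR_mulrn ?ltW // -powRrM; ring.
rewrite powRM ?powR_ge0 ?(ltW Q0) // -powRrM mulrAC -powRD; last first.
  by rewrite [s == _]gt_eqF // implybT.
by rewrite (_ : r * (1 / r - 1) + (r - 1) = 0) ?powRr0 ?mul1r //; field.
Qed.

(** The monotonicity of power means is Jensen's inequality for the exponent 2 * r;
    the direction of the result changes with the sign of 1 / r - 1. *)
Lemma power_mean_ge_half (R : realType) (I : finType) (w y : I -> R) (r m : R) :
  1 / 2 < r -> (forall i, 0 <= w i) -> \sum_i w i = 1 -> (forall i, 0 < y i) ->
  m = \sum_i w i * y i -> 0 < m ->
  [/\ 0 < \sum_i w i * y i `^ (2 * r),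
      r <= 1 -> m `^ (2 - 2 * r) <= (\sum_i w i * y i `^ (2 * r)) `^ (1 / r - 1) &
      1 <= r -> (\sum_i w i * y i `^ (2 * r)) `^ (1 / r - 1) <= m `^ (2 - 2 * r)].
Proof.
move=> r2 w0 w1 y0 em m0; have r0 : 0 < r by lra.
have J : m `^ (2 * r) <= \sum_i w i * y i `^ (2 * r).
  by rewrite em; apply: jensen_powR => //; [lra | rewrite -em].
set Q := \sum_i w i * y i `^ _ in J *.
have Q0 : 0 < Q by apply: lt_le_trans J; rewrite powR_gt0.
have -> : m `^ (2 - 2 * r) = (m `^ (2 * r)) `^ (1 / r - 1).
  by rewrite -powRrM; congr (_ `^ _); field; rewrite gt_eqF.
split=> // r1.
  by rewrite ge0_ler_powR ?nnegrE ?powR_ge0 ?(ltW Q0) // subr_ge0 ler_pdivlMr // mul1r.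
rewrite -(opprB 1 (1 / r)) !powRN lef_pV2 ?posrE ?powR_gt0 //.
by rewrite ge0_ler_powR ?nnegrE ?powR_ge0 ?(ltW Q0) // subr_ge0 ler_pdivrMr // mul1r.
Qed.

(** In the variables y i = sqrt (X i / s) the slope depends only on the ratios of
    the X i to the largest value s, and the power mean of exponent 1 / 2 becomes
    an arithmetic mean. *)
Lemma slope_rescaled (R : realType) (I : finType) (w X : I -> R) (i0 : I) (r s : R) :
  1 / 2 < r -> (forall i, 0 < w i) -> \sum_i w i = 1 ->
  0 < X i0 -> (forall i, X i0 <= X i <= s) ->
  exists2 y : I -> R,
    [/\ forall i, 0 < y i, forall i, y i0 <= y i <= 1,
        X i0 < s -> y i0 < 1 & forall i, X i = s -> y i = 1] &
    [/\ (s - \sum_i w i * X i) / X i0 =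
          \sum_i w i * (1 - y i ^+ 2) / y i0 ^+ 2,
        (\sum_i w i * X i `^ (1 / 2)) * s `^ (- (1 / 2)) = \sum_i w i * y i,
        expR (\sum_i w i * ln (X i)) / s = expR (2 * \sum_i w i * ln (y i)) &
        (\sum_i w i * X i `^ r) `^ (1 / r - 1) * s `^ (r - 1) =
          (\sum_i w i * y i `^ (2 * r)) `^ (1 / r - 1)].
Proof.
move=> r2 w0 w1 X0 Xb; have s0 : 0 < s.
  by case/andP: (Xb i0) => _; exact: lt_le_trans.
have Xp i : 0 < X i by case/andP: (Xb i) => h _; exact: lt_le_trans h.
pose y i := (X i / s) `^ (1 / 2).
have yE i : y i = (X i / s) `^ (1 / 2) by [].
clearbody y; have yp i : 0 < y i by rewrite yE powR_gt0 // divr_gt0.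
have y2 i : y i ^+ 2 = X i / s.
  rewrite -powR_mulrn ?(ltW (yp i)) // yE -powRrM (_ : 1 / 2 * 2 = 1); last by field.
  by rewrite powRr1 // divr_ge0 // ltW.
have XE i : X i = s * y i ^+ 2 by rewrite y2; field; rewrite gt_eqF.
have Q0 : 0 < \sum_i w i * y i `^ (2 * r).
  rewrite (bigD1 i0) //= ltr_wpDr ?mulr_gt0 ?powR_gt0 // sumr_ge0 // => i _.
  by rewrite mulr_ge0 ?powR_ge0 // ltW.
exists y; split.
- exact: yp.
- move=> i; have /andP[h1 h2] := Xb i; apply/andP; split.
    rewrite !yE; apply: ge0_ler_powR; rewrite ?nnegrE ?divr_ge0 ?(ltW s0) ?(ltW (Xp _)) //.
    by rewrite ler_wpM2r // invr_ge0 ltW.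
  rewrite -(expr_le1 (n := 2)) ?(ltW (yp i)) // y2 ler_pdivrMr // mul1r //.
- move=> h; rewrite -(expr_lt1 (n := 2)) ?(ltW (yp i0)) // y2 ltr_pdivrMr //.
  by rewrite mul1r.
- by move=> i h; rewrite yE h divff ?gt_eqF // powR1.
- have -> : s - \sum_i w i * X i = s * \sum_i w i * (1 - y i ^+ 2).
    rewrite -{1}(mulr1 s) -{1}w1 !mulr_sumr -sumrB; apply: eq_bigr => i _.
    by rewrite XE; ring.
  by rewrite -mulr_suml [in LHS](XE i0); field; rewrite !gt_eqF.
- rewrite mulr_suml; apply: eq_bigr => i _.
  rewrite -mulrA yE powRM ?invr_ge0 ?(ltW s0) ?(ltW (Xp _)) //.
  by rewrite -(powR_inv1 (ltW s0)) -powRrM mulN1r.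
- rewrite -[in LHS](lnK s0) -expRN -expRD; congr expR.
  rewrite mulr_sumr -[ln s]mul1r -{1}w1 mulr_suml -sumrB; apply: eq_bigr => i _.
  by rewrite yE ln_powR ln_div ?posrE //; field.
- have -> : \sum_i w i * X i `^ r = \sum_i w i * (s * y i ^+ 2) `^ r.
    by apply: eq_bigr => i _; rewrite -(XE i).
  exact: power_mean_homogeneous r2 (fun i => ltW (w0 i)) s0 yp Q0.
Qed.

Lemma derivative_below (R : realType) (I : finType) (w X : I -> R) (i0 i1 : I)
    (r q c s : R) :
  1 / 2 < r <= 1 -> 0 < q <= 1 / 2 -> r < 1 \/ q < 1 / 2 ->
  (forall i, q <= w i) -> \sum_i w i = 1 ->
  0 < X i0 < s -> (forall i, X i0 <= X i <= s) -> X i1 = s ->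
  c = q `^ (2 - 1 / r) ->
  0 < (1 / 2 - r * c) * ((s - \sum_i w i * X i) / X i0)
      + c * ((\sum_i w i * X i `^ r) `^ (1 / r - 1) * s `^ (r - 1))
      + (1 - c) * (expR (\sum_i w i * ln (X i)) / s)
      - (\sum_i w i * X i `^ (1 / 2)) * s `^ (- (1 / 2)).
Proof.
move=> r01 q01 rq qw w1 /andP[X0 Xs] Xb Xi1 ec.
have [r2 r1] := andP r01; have [q0 _] := andP q01.
have w0 i : 0 < w i := lt_le_trans q0 (qw i).
have [y [yp yb y1 ys] [-> em -> ->]] := slope_rescaled r2 w0 w1 X0 Xb.
rewrite em; have m0 : 0 < \sum_i w i * y i.
  rewrite (bigD1 i0) //= ltr_wpDr ?mulr_gt0 // sumr_ge0 // => i _.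
  by rewrite mulr_ge0 // ltW.
have [_ + _] := power_mean_ge_half r2 (fun i => ltW (w0 i)) w1 yp erefl m0.
move=> /(_ r1) hQ; have c0 : 0 <= c by rewrite ec powR_ge0.
have y01 : 0 < y i0 < 1 by rewrite yp y1.
have := slope_below r01 q01 rq qw w1 y01 yb (ys i1 Xi1) ec erefl.
have := ler_wpM2l c0 hQ; clear; lra.
Qed.

Lemma derivative_above (R : realType) (I : finType) (w X : I -> R) (i0 i1 : I)
    (r q c s : R) :
  1 <= r <= 2 -> 0 < q <= 1 / 2 -> 1 < r \/ q < 1 / 2 ->
  (forall i, q <= w i) -> \sum_i w i = 1 ->
  0 < X i0 < s -> (forall i, X i0 <= X i <= s) -> X i1 = s ->
  c = (1 - q) `^ (2 - 1 / r) ->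
  (1 / 2 - r * c) * ((s - \sum_i w i * X i) / X i0)
      + c * ((\sum_i w i * X i `^ r) `^ (1 / r - 1) * s `^ (r - 1))
      + (1 - c) * (expR (\sum_i w i * ln (X i)) / s)
      - (\sum_i w i * X i `^ (1 / 2)) * s `^ (- (1 / 2)) < 0.
Proof.
move=> r12 q01 rq qw w1 /andP[X0 Xs] Xb Xi1 ec.
have [r1 _] := andP r12; have [q0 _] := andP q01.
have r2 : 1 / 2 < r by lra.
have w0 i : 0 < w i := lt_le_trans q0 (qw i).
have [y [yp yb y1 ys] [-> em -> ->]] := slope_rescaled r2 w0 w1 X0 Xb.
rewrite em; have m0 : 0 < \sum_i w i * y i.
  rewrite (bigD1 i0) //= ltr_wpDr ?mulr_gt0 // sumr_ge0 // => i _.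
  by rewrite mulr_ge0 // ltW.
have [_ _] := power_mean_ge_half r2 (fun i => ltW (w0 i)) w1 yp erefl m0.
move=> /(_ r1) hQ; have c0 : 0 <= c by rewrite ec powR_ge0.
have y01 : 0 < y i0 < 1 by rewrite yp y1.
have := slope_above r12 q01 rq qw w1 y01 yb (ys i1 Xi1) ec erefl.
have := ler_wpM2l c0 hQ; clear; lra.
Qed.

(** * The gap along the path *)

(** The right-hand side minus the left-hand side of both inequalities, with the
    factor c and the number b = x_1 kept fixed while the other values move. *)
Definition gap (R : realType) (n : nat) (w x : 'I_n -> R) (r c b : R) : R :=
  (1 / 2 - r * c) / (2 * b) * weighted_variance w x
  - (power_mean w x (1 / 2) - c * power_mean w x r - (1 - c) * geom_mean w x).

Lemma arith_meanE (R : realType) (n : nat) (w x : 'I_n -> R) :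
  (forall i, 0 < w i) -> (forall i, 0 < x i) ->
  arith_mean w x = \sum_i w i * x i.
Proof.
move=> w0 x0; rewrite /arith_mean /power_mean oner_eq0 divr1.
have -> : \sum_i w i * x i `^ 1 = \sum_i w i * x i.
  by apply: eq_bigr => i _; rewrite powRr1 // ltW.
by rewrite powRr1 // sumr_ge0 // => i _; rewrite mulr_ge0 ?ltW.
Qed.

Lemma weighted_varianceE (R : realType) (n : nat) (w x : 'I_n -> R) :
  (forall i, 0 < w i) -> \sum_i w i = 1 -> (forall i, 0 < x i) ->
  weighted_variance w x = \sum_i w i * x i ^+ 2 - (\sum_i w i * x i) ^+ 2.
Proof.
move=> w0 w1 x0; rewrite /weighted_variance arith_meanE //.
set m := \sum_i w i * x i.
transitivity (\sum_i (w i * x i ^+ 2 - 2 * m * (w i * x i) + m ^+ 2 * w i)).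
  by apply: eq_bigr => i _; ring.
by rewrite big_split /= sumrB -!mulr_sumr w1 -/m; ring.
Qed.

Lemma gapE (R : realType) (n : nat) (w x : 'I_n -> R) (r c b : R) :
  (forall i, 0 < w i) -> \sum_i w i = 1 -> (forall i, 0 < x i) -> r != 0 ->
  gap w x r c b =
  (1 / 2 - r * c) / (2 * b)
    * (\sum_i w i * x i ^+ 2 - (\sum_i w i * x i) ^+ 2)
  - (\sum_i w i * x i `^ (1 / 2)) ^+ 2
  + c * (\sum_i w i * x i `^ r) `^ (1 / r)
  + (1 - c) * expR (\sum_i w i * ln (x i)).
Proof.
move=> w0 w1 x0 r0; rewrite /gap weighted_varianceE // /geom_mean /power_mean.
rewrite eqxx (negbTE r0) gt_eqF //.
rewrite (_ : 1 / (1 / 2) = 2%:R :> R); last by field.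
rewrite powR_mulrn; last first.
  by rewrite sumr_ge0 // => i _; rewrite mulr_ge0 ?powR_ge0 // ltW.
have -> : \prod_i x i `^ w i = expR (\sum_i w i * ln (x i)).
  by rewrite expR_sum; apply: eq_bigr => i _; rewrite /powR gt_eqF.
ring.
Qed.

(** A point of the path from the constant family to x: the values that
    have not reached their final position move together. *)
Definition stop_at (R : realType) (n : nat) (x : 'I_n -> R) (k : nat) (s : R)
  (i : 'I_n) : R := if (i <= k)%N then x i else s.

Lemma sum_stop_at (R : realType) (n : nat) (w x : 'I_n -> R) (k : nat) (s : R)
    (g : R -> R) :
  \sum_i w i * g (stop_at x k s i) =
  \sum_(i < n | (i <= k)%N) w i * g (x i) + (\sum_(i < n | ~~ (i <= k)%N) w i) * g s.
Proof.
rewrite (bigID (fun i : 'I_n => (i <= k)%N)) /= mulr_suml; congr (_ + _).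
  by apply: eq_bigr => i ik; rewrite /stop_at ik.
by apply: eq_bigr => i /negbTE ik; rewrite /stop_at ik.
Qed.

(** The derivative of the gap along the moving values, divided by their total
    weight. *)
Definition gap_slope (R : realType) (n : nat) (w X : 'I_n -> R) (r c b s : R) : R :=
  (1 / 2 - r * c) * ((s - \sum_i w i * X i) / b)
      + c * ((\sum_i w i * X i `^ r) `^ (1 / r - 1) * s `^ (r - 1))
      + (1 - c) * (expR (\sum_i w i * ln (X i)) / s)
      - (\sum_i w i * X i `^ (1 / 2)) * s `^ (- (1 / 2)).

Lemma is_derive_gap (R : realType) (n : nat) (w x : 'I_n -> R) (r c b : R)
    (k : nat) (s : R) :
  (forall i, 0 < w i) -> (forall i, 0 < x i) -> r != 0 -> b != 0 -> 0 < s ->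
  (0 < n)%N ->
  is_derive s 1 (fun t =>
    (1 / 2 - r * c) / (2 * b)
      * (\sum_i w i * stop_at x k t i ^+ 2 - (\sum_i w i * stop_at x k t i) ^+ 2)
    - (\sum_i w i * stop_at x k t i `^ (1 / 2)) ^+ 2
    + c * (\sum_i w i * stop_at x k t i `^ r) `^ (1 / r)
    + (1 - c) * expR (\sum_i w i * ln (stop_at x k t i)))
  ((\sum_(i < n | ~~ (i <= k)%N) w i) * gap_slope w (stop_at x k s) r c b s).
Proof.
move=> w0 x0 r0 b0 s0 n0; set p := \sum_(i < n | _) _.
have S (g dg : R -> R) : is_derive s 1 g (dg s) ->
  is_derive s 1 (fun t => \sum_i w i * g (stop_at x k t i)) (p * dg s).
  move=> hg; have -> : (fun t => \sum_i w i * g (stop_at x k t i)) =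
      (fun t => \sum_(i < n | (i <= k)%N) w i * g (x i) + p * g t).
    by apply/funext => t; rewrite sum_stop_at.
  rewrite -[p * dg s]add0r.
  exact: is_derive_add (is_derive_const _ _) (is_derive_scale p hg).
have hid : is_derive s 1 (fun t : R => t) 1 := is_derive_id s 1.
have h2 := S (fun t => t ^+ 2) (fun t => 2 * t * 1) (is_derive_sqr hid).
have h1 := S (fun t => t) (fun=> 1) hid.
have hh := S (fun t => t `^ (1 / 2)) (fun t => 1 / 2 * t `^ (1 / 2 - 1) * 1)
  (is_derive_powR (1 / 2) s0 hid).
have hr := S (fun t => t `^ r) (fun t => r * t `^ (r - 1) * 1)
  (is_derive_powR r s0 hid).
have hl := S (@ln R) (fun t => t^-1) (is_derive1_ln s0).
have P0 : 0 < \sum_i w i * stop_at x k s i `^ r.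
  rewrite (bigD1 (Ordinal n0)) //= ltr_wpDr //.
    by rewrite sumr_ge0 // => i _; rewrite mulr_ge0 ?powR_ge0 // ltW.
  rewrite mulr_gt0 // powR_gt0 // /stop_at; by case: (_ <= _)%N.
have := is_derive_add (is_derive_add (is_derive_sub
  (is_derive_scale ((1 / 2 - r * c) / (2 * b)) (is_derive_sub h2 (is_derive_sqr h1)))
  (is_derive_sqr hh))
  (is_derive_scale c (is_derive_powR (1 / r) P0 hr)))
  (is_derive_scale (1 - c) (is_derive_comp
    (is_derive_expR (\sum_i w i * ln (stop_at x k s i))) hl)).
move=> H; apply: (is_derive_eq H).
rewrite /gap_slope (_ : 1 / 2 - 1 = - (1 / 2)); last by field.
by field; rewrite r0 b0 gt_eqF.
Qed.

Lemma gap_const (R : realType) (n : nat) (w x : 'I_n -> R) (r c b a : R) :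
  (forall i, 0 < w i) -> \sum_i w i = 1 -> 0 < a -> (forall i, x i = a) ->
  r != 0 -> gap w x r c b = 0.
Proof.
move=> w0 w1 a0 xa r0; rewrite gapE // => [|i]; last by rewrite xa.
have S g : \sum_i w i * g (x i) = g a.
  by rewrite -[RHS]mul1r -w1 mulr_suml; apply: eq_bigr => i _; rewrite xa.
rewrite (S (fun t => t ^+ 2)) (S id) (S (fun t => t `^ (1 / 2))).
rewrite (S (fun t => t `^ r)) (S (@ln R)) lnK //.
have -> : (a `^ (1 / 2)) ^+ 2 = a.
  rewrite -powR_mulrn ?powR_ge0 // -powRrM (_ : 1 / 2 * 2 = 1); last by field.
  by rewrite powRr1 // ltW.
have -> : (a `^ r) `^ (1 / r) = a.
  rewrite -powRrM (_ : r * (1 / r) = 1); last by field.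
  by rewrite powRr1 // ltW.
ring.
Qed.

Lemma gap_step (R : realType) (n : nat) (w x : 'I_n -> R) (r c b sg : R)
    (k : nat) (u v : R) :
  (forall i, 0 < w i) -> \sum_i w i = 1 -> (forall i, 0 < x i) ->
  r != 0 -> b != 0 -> (k.+1 < n)%N -> 0 < u < v ->
  (forall s, u < s -> 0 < sg * gap_slope w (stop_at x k s) r c b s) ->
  sg * gap w (stop_at x k u) r c b < sg * gap w (stop_at x k v) r c b.
Proof.
move=> w0 w1 x0 r0 b0 kn /andP[u0 uv] slope.
have xs0 s : 0 < s -> forall i, 0 < stop_at x k s i.
  by move=> s0 i; rewrite /stop_at; case: (_ <= _)%N.
have n0 : (0 < n)%N by apply: leq_trans kn.
have hd t (tuv : u <= t <= v) := @is_derive_gap _ _ w x r c b k t w0 x0 r0 b0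
  (lt_le_trans u0 (proj1 (andP tuv))) n0.
have [s /andP[us sv] e] := mean_value uv hd.
rewrite !gapE //; try by apply: xs0 => //; exact: lt_trans uv.
rewrite -subr_gt0 -mulrBr e -!mulrA mulrCA [sg * _]mulrA.
apply: mulr_gt0; last by apply: mulr_gt0; [exact: slope | rewrite subr_gt0].
rewrite (bigD1 (Ordinal kn)) /= ?ltnn // ltr_wpDr // sumr_ge0 // => i _.
exact: ltW.
Qed.

(** Along the path that raises the values one index after the other, from the
    constant family to x, the gap starts at 0 and moves strictly in the direction
    of sg whenever two consecutive values differ. *)
Lemma gap_sign (R : realType) (n : nat) (hn : (1 < n)%N) (w x : 'I_n -> R)
    (r c b sg : R) :
  (forall i, 0 < w i) -> \sum_i w i = 1 -> 0 < x (first_ord hn) ->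
  (forall i j : 'I_n, (i <= j)%N -> x i <= x j) -> r != 0 -> b != 0 ->
  (forall (k : 'I_n) s, (k.+1 < n)%N -> x k < s ->
     0 < sg * gap_slope w (stop_at x k s) r c b s) ->
  ~ (forall i j, x i = x j) -> 0 < sg * gap w x r c b.
Proof.
move=> w0 w1 xf mono r0 b0 slope neq.
have x0 i : 0 < x i by apply: lt_le_trans xf _; exact: mono.
(* The point of the path where the moving values have reached x_m. *)
have path m (hm : (m < n)%N) :
    0 <= sg * gap w (stop_at x m (x (Ordinal hm))) r c b /\
    (x (first_ord hn) < x (Ordinal hm) ->
     0 < sg * gap w (stop_at x m (x (Ordinal hm))) r c b).
  elim: m hm => [|m IH] hm.
    rewrite (_ : Ordinal hm = first_ord hn); last exact/val_inj.
    rewrite ltxx (gap_const c b w0 w1 xf) ?mulr0 // => i.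
    rewrite /stop_at leqn0; case: eqP => // i0.
    by congr x; exact/val_inj.
  have hm' : (m < n)%N by apply: leq_trans hm.
  have [IH1 IH2] := IH hm'.
  have -> : stop_at x m.+1 (x (Ordinal hm)) = stop_at x m (x (Ordinal hm)).
    apply/funext => i; rewrite /stop_at leq_eqVlt ltnS.
    case: eqP => //= im; case: ifP => // _.
    by congr x; exact/val_inj.
  have le_m : x (Ordinal hm') <= x (Ordinal hm) by exact: mono.
  have [lt_m|ge_m] := ltP (x (Ordinal hm')) (x (Ordinal hm)).
    have uv : 0 < x (Ordinal hm') < x (Ordinal hm) by rewrite x0.
    have step := gap_step w0 w1 x0 r0 b0 hm uv (fun s => slope (Ordinal hm') s hm).
    by split => [|_]; [exact: le_trans IH1 (ltW step)|exact: le_lt_trans IH1 step].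
  have e : x (Ordinal hm) = x (Ordinal hm') by apply/eqP; rewrite eq_le ge_m.
  by rewrite e.
have hl : (n.-1 < n)%N by rewrite prednK // (leq_trans _ hn).
have := path _ hl; rewrite (_ : stop_at x _ _ = x); last first.
  apply/funext => i; rewrite /stop_at (_ : (i <= n.-1)%N) //.
  by rewrite -ltnS prednK // (leq_trans _ hn).
case=> _; apply; rewrite lt_neqAle; apply/andP; split; last exact: mono.
apply/eqP => e.
apply: neq; suff h i : x i = x (first_ord hn) by move=> i j; rewrite !h.
apply/eqP; rewrite eq_le; apply/andP; split; last exact: mono.
rewrite e; apply: mono => /=.
by rewrite -ltnS prednK // (leq_trans _ hn).
Qed.

(** * The number r_0 *)

(** Two tangents of ln, at 2 and at 3. *)
Lemma ln3_ge (R : realType) : 5 / 6 <= ln (3 : R).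
Proof.
have h2 := @ln_tangent R 1 2 ltr01 (ltr0n _ 2).
have h3 := @ln_tangent R 2 3 (ltr0n _ 2) (ltr0n _ 3).
rewrite ln1 in h2; lra.
Qed.

(** Going from b down to a multiplies 3 `^ (1 / r) by 3 `^ d, and the tangent of
    the exponential makes this too large to be compensated by the factor
    3 * r + 1 of slope 3. *)
Lemma is_r0_not_lt (R : realType) (a b : R) :
  is_r0 a -> is_r0 b -> a < b -> False.
Proof.
move=> [a2 a1 ea] [b2 b1 eb] ab; have [a0 b0] : 0 < a /\ 0 < b by lra.
pose d := 1 / a - 1 / b.
have dE : d = (b - a) / (a * b) by rewrite /d; field; rewrite !gt_eqF.
have d0 : 0 < d by rewrite dE divr_gt0 ?mulr_gt0 ?subr_gt0.
have h : 1 + 5 / 6 * d <= 3 `^ d.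
  rewrite /powR gt_eqF //; apply: le_trans (expR_ge1Dx _).
  by rewrite lerD2l mulrC ler_wpM2l ?(ltW d0) // ln3_ge.
have e3 : 3 `^ (1 / a) = 3 `^ (1 / b) * 3 `^ d :> R.
  by rewrite -powRD ?pnatr_eq0 ?implybT // /d addrC subrK.
have p3 : 0 < 3 `^ (1 / b) :> R by rewrite powR_gt0.
have {ea eb} e : (3 * a + 1) * 3 `^ d = 3 * b + 1.
  by apply: (mulIf (lt0r_neq0 p3)); rewrite eb -ea e3; ring.
have h' : (3 * a + 1) * (1 + 5 / 6 * d) <= 3 * b + 1.
  by rewrite -e ler_wpM2l //; lra.
have bE : b = a + d * (a * b) by rewrite dE; field; rewrite !gt_eqF.
have : 5 / 6 * (3 * a + 1) * d <= 3 * (a * b) * d by move: h'; rewrite {1}bE; lra.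
rewrite ler_pM2r // => {}h'.
have : a * b < a by rewrite gtr_pMr.
lra.
Qed.

Lemma is_r0_exists (R : realType) : exists r : R, is_r0 r.
Proof.
pose F (r : R) := (3 * r + 1) * expR (ln 3 * r `^ (-1)).
have FE r : 0 < r -> F r = (3 * r + 1) * 3 `^ (1 / r).
  by move=> r0; rewrite /F powR_inv1 ?ltW // /powR gt_eqF // mulrC div1r [ln 3 * _]mulrC mulrC.
have F2 : F (1 / 2) = 45 / 2.
  rewrite FE // (_ : 1 / (1 / 2) = 2%:R :> R); last by field.
  by rewrite powR_mulrn //; field.
have F1 : F 1 = 12 by rewrite FE // divr1 powRr1 //; ring.
have Fc : {within `[1 / 2, 1]%classic, continuous F}%classic.
  apply: derivable_within_continuous => r; rewrite in_itv /= => /andP[r2 _].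
  have r0 : 0 < r by apply: lt_le_trans r2.
  have hid : is_derive r 1 (fun t : R => t) 1 := is_derive_id r 1.
  have h1 := is_derive_add (is_derive_scale 3 hid) (is_derive_const 1 r).
  have h2 := @is_derive_comp _ expR (fun t => ln 3 * t `^ (-1)) _ _ _
    (is_derive_expR _) (is_derive_scale (ln 3) (is_derive_powR (-1) r0 hid)).
  by have [] := is_deriveM h1 h2.
clearbody F.
have [|||r] := @IVT R F (1 / 2) 1 (63 / 4) => //.
- lra.
- by rewrite F2 F1 /Num.min /Num.max; do !case: ifP; lra.
rewrite in_itv /= => /andP[r2 r1] Fr; exists r.
have r0 : 0 < r by lra.
split; last by rewrite -FE.
- rewrite lt_neqAle r2 andbT; apply/eqP => e.
  by move: Fr; rewrite -e F2; lra.
- rewrite lt_neqAle r1 andbT; apply/eqP => e.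
  by move: Fr; rewrite e F1; lra.
Qed.

(** * Smallest weight and the case of equality *)

Lemma min_weight_le (R : realType) (n : nat) (hn : (1 < n)%N) (w : 'I_n -> R) i :
  min_weight hn w <= w i.
Proof. exact: bigmin_le_cond. Qed.

Lemma min_weight_gt0 (R : realType) (n : nat) (hn : (1 < n)%N) (w : 'I_n -> R) :
  (forall i, 0 < w i) -> 0 < min_weight hn w.
Proof. by move=> w0; apply: lt_bigmin. Qed.

Lemma min_weight_half (R : realType) (n : nat) (hn : (1 < n)%N) (w : 'I_n -> R) :
  (forall i, 0 < w i) -> \sum_i w i = 1 ->
  min_weight hn w <= 1 / 2 /\ (min_weight hn w = 1 / 2 -> n = 2%N).
Proof.
move=> w0 w1; set q := min_weight hn w.
have q0 : 0 < q by exact: min_weight_gt0.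
have nq : n%:R * q <= 1.
  rewrite -[leRHS]w1 mulr_natl -[n in q *+ n]card_ord -sumr_const.
  by apply: ler_sum => i _; exact: min_weight_le.
split.
  have : 2%:R * q <= n%:R * q by rewrite ler_wpM2r ?ler_nat // ltW.
  lra.
move=> q2; move: nq; rewrite q2 => nq; apply/eqP.
rewrite eqn_leq hn andbT -(ler_nat R); lra.
Qed.

(** The identity ((u + v) / 2) ^+ 2 = (u ^+ 2 + v ^+ 2) / 4 + u * v / 2 with u and
    v the square roots of the two values; the variance has coefficient 0. *)
Lemma gap_two_equal_weights (R : realType) (w x : 'I_2 -> R) (b : R) :
  (forall i, 1 / 2 <= w i) -> \sum_i w i = 1 -> (forall i, 0 < x i) ->
  gap w x 1 (1 / 2) b = 0.
Proof.
move=> wq w1 x0.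
have w2 i : w i = 1 / 2.
  have wi0 j : true -> 0 <= w j - 1 / 2 by rewrite subr_ge0.
  apply/eqP; rewrite -subr_eq0; apply/eqP; apply: (psumr_eq0P wi0) => //.
  by rewrite sumrB w1 sumr_const card_ord -mulr_natl; field.
rewrite gapE ?oner_eq0 // => [|i]; last by rewrite w2.
have m0 : 0 <= 1 / 2 * x ord0 + (1 / 2 * x (lift ord0 ord0) + 0).
  by have := x0 ord0; have := x0 (lift ord0 ord0); lra.
rewrite !big_ord_recl !big_ord0 /= !w2 !divr1 !powRr1 ?(ltW (x0 _)) //.
set a := x ord0; set a' := x _.
have -> : expR (1 / 2 * ln a + (1 / 2 * ln a' + 0)) = a `^ (1 / 2) * a' `^ (1 / 2).
  by rewrite addr0 expRD /powR !gt_eqF ?x0.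
have s2 (t : R) : 0 < t -> t = (t `^ (1 / 2)) ^+ 2.
  move=> t0; rewrite -powR_mulrn ?powR_ge0 // -powRrM (_ : 1 / 2 * 2 = 1); last by field.
  by rewrite powRr1 // ltW.
have := s2 a (x0 _); have := s2 a' (x0 _); lra.
Qed.

(** * The inequalities *)

(** Used with sg = 1 and sg = -1; off the set E of equality cases the gap has a
    strict sign. *)
Lemma equality_cases (R : realType) (n : nat) (w x : 'I_n -> R) (r c b lhs rhs : R)
    (sg : R) (E : Prop) :
  rhs - lhs = gap w x r c b -> (E -> gap w x r c b = 0) ->
  (~ E -> 0 < sg * gap w x r c b) ->
  0 <= sg * (rhs - lhs) /\ (lhs = rhs <-> E).
Proof.
move=> e hE hnE; rewrite e; have [PE|nE] := pselect E.
  split; first by rewrite hE // mulr0.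
  split=> // _.
  by apply/esym/eqP; rewrite -subr_eq0 e hE.
split; first exact: ltW (hnE nE).
split=> // h; move: (hnE nE); rewrite -e h subrr mulr0 ltxx //.
Qed.

Theorem theorem1p2 (R : realType) :
  (exists! r0 : R, is_r0 r0) /\
  forall r0 : R, is_r0 r0 ->
  forall (n : nat) (hn : (1 < n)%N) (x w : 'I_n -> R),
    0 < x (first_ord hn) ->
    (forall i j : 'I_n, (i <= j)%N -> x i <= x j) ->
    (forall i : 'I_n, 0 < w i) ->
    \sum_(i < n) w i = 1 ->
    let q := min_weight hn w in
    let x1 := x (first_ord hn) in
    let M := power_mean w x in
    let G := geom_mean w x in
    let sigma := weighted_variance w x in
    (forall r : R, r0 <= r -> r <= 1 ->
       let c := q `^ (2 - 1 / r) in
       let lhs := M (1 / 2) - c * M r - (1 - c) * G in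
       let rhs := (1 / 2 - r * c) / (2 * x1) * sigma in
       lhs <= rhs /\
       (lhs = rhs <->
          (forall i j : 'I_n, x i = x j) \/ [/\ r = 1, n = 2%N & q = 1 / 2]))
    /\
    (forall r : R, 1 <= r -> r <= 2 ->
       let c := (1 - q) `^ (2 - 1 / r) in
       let lhs := M (1 / 2) - c * M r - (1 - c) * G in
       let rhs := (1 / 2 - r * c) / (2 * x1) * sigma in
       rhs <= lhs /\
       (lhs = rhs <->
          (forall i j : 'I_n, x i = x j) \/ [/\ r = 1, n = 2%N & q = 1 / 2])).
Proof.
split.
  have [r hr] := @is_r0_exists R; exists r; split => // r' hr'.
  by have [/(is_r0_not_lt hr hr')|/(is_r0_not_lt hr' hr)|] := ltgtP r r'.
move=> r0 [r02 _ _] n hn x w xf mono w0 w1 q x1 M G sigma.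
have [q2 qn] := min_weight_half hn w0 w1.
have q0 := min_weight_gt0 hn w0; rewrite -/q in q0 q2 qn.
have q01 : 0 < q <= 1 / 2 by rewrite q0.
have qw i : q <= w i := min_weight_le hn w i.
have x0 i : 0 < x i by apply: lt_le_trans xf _; exact: mono.
have x1n0 : x1 != 0 by rewrite gt_eqF.
have stop_bounds (k : 'I_n) s : (k.+1 < n)%N -> x k < s ->
    [/\ 0 < stop_at x k s (first_ord hn) < s,
        forall i, stop_at x k s (first_ord hn) <= stop_at x k s i <= s &
        exists i, stop_at x k s i = s].
  move=> kn ks; have x1s : x1 < s by apply: le_lt_trans ks; exact: mono.
  split.
  - by rewrite /stop_at /= xf.
  - move=> i; rewrite {1}/stop_at /= /stop_at; case: ifP => ik.
      by rewrite mono //= (le_trans _ (ltW ks)) // mono.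
    by rewrite lexx (ltW x1s).
  - by exists (Ordinal kn); rewrite /stop_at /= ltnn.
have degenerate r : [/\ r = 1, n = 2%N & q = 1 / 2] -> forall c, c = 1 / 2 ->
    gap w x r c x1 = 0.
  move=> [-> n2 eq2] c ->; have wq i : 1 / 2 <= w i by rewrite -eq2.
  move: (x1) => b; clear - n2 wq w1 x0; subst n.
  exact: gap_two_equal_weights.
have equal r c : r != 0 -> (forall i j, x i = x j) -> gap w x r c x1 = 0.
  by move=> rn0 xe; apply: gap_const w0 w1 xf _ rn0 => i; exact: xe.
split=> r rl ru c lhs rhs.
- have rn0 : r != 0 by rewrite gt_eqF //; lra.
  have r01 : 1 / 2 < r <= 1 by rewrite ru (lt_le_trans r02).
  rewrite -[lhs <= rhs]subr_ge0 -[rhs - lhs]mul1r.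
  apply: (@equality_cases _ _ w x r c x1) => //.
    case=> [|[er n2 eq2]]; first exact: equal.
    apply: degenerate => //.
    by rewrite /c er eq2 divr1 (_ : 2 - 1 = 1) ?powRr1 //; lra.
  move=> nE; apply: gap_sign => //; last by move=> h; apply: nE; left.
  move=> k s kn ks; rewrite mul1r.
  have [h1 h2 [i1 h3]] := stop_bounds k s kn ks.
  apply: (derivative_below r01 q01 _ qw w1 h1 h2 h3) => //.
  have [|r1] := ltP r 1; first by left.
  have [|q1] := ltP q (1 / 2); first by right.
  have er : r = 1 by lra.
  have eq : q = 1 / 2 by lra.
  by case: nE; right; split=> //; exact: qn.
- have rn0 : r != 0 by rewrite gt_eqF //; lra.
  have r12 : 1 <= r <= 2 by rewrite rl.
  rewrite -[rhs <= lhs]subr_ge0 -[lhs - rhs]opprB -mulN1r.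
  apply: (@equality_cases _ _ w x r c x1) => //.
    case=> [|[er n2 eq2]]; first exact: equal.
    apply: degenerate => //.
    by rewrite /c er eq2 divr1 (_ : 2 - 1 = 1) ?powRr1 //; lra.
  move=> nE; apply: gap_sign => //; last by move=> h; apply: nE; left.
  move=> k s kn ks; rewrite mulN1r oppr_gt0.
  have [h1 h2 [i1 h3]] := stop_bounds k s kn ks.
  apply: (derivative_above r12 q01 _ qw w1 h1 h2 h3) => //.
  have [|r1] := ltP 1 r; first by left.
  have [|q1] := ltP q (1 / 2); first by right.
  have er : r = 1 by lra.
  have eq : q = 1 / 2 by lra.
  by case: nE; right; split=> //; exact: qn.
Qed.
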